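(* Let $n=2m$ be even. Suppose $(\beta,\omega,\zeta)$ corresponds to a geodesic $A(t)$ of $\mathsf{SL}(n)$ with the HS metric and satisfies the block diagonal assumption, with component functions $b_0,b_1,b_2,w_0,w_1,w_2:\mathbb{R}\to\mathbb{R}^m$ and $z\in\mathbb{R}^m$, such that $b_1=w_1=b_2=w_2=0$ at some time. Suppose further that $z_i\neq0$ for every $i=1,\dots,m$. Then the motion described by $\beta,\omega,\zeta$ is bounded (the geodesic stays in a bounded subset of $\mathcal{M}(n)$).
   Context: $\mathcal{M}(n)$ is the space of real $n\times n$ matrices with the Hilbert-Schmidt inner product $\langle A,B\rangle=\operatorname{tr}(AB^T)$; the HS metric on $\mathsf{SL}(n)=\{\det A=1\}$ is the induced Riemannian metric. A curve $A(t)$ in $\mathsf{SL}(n)$ is a geodesic iff $A''=\frac{\operatorname{tr}(A'A^{-1}A'A^{-1})}{\operatorname{tr}(A^{-1}A^{-T})}A^{-T}$. To a geodesic $A(t)$ one associates \[\beta=A^{-1}A^{-T},\quad \omega=A^TA'+(A^T)'A,\quad \zeta=A^TA'-(A^T)'A.\] Then $\beta$ is symmetric positive definite with determinant 1, $\omega$ is symmetric with $\operatorname{tr}(\beta\omega)=0$, $\zeta$ is antisymmetric, and they satisfy \[\beta'=-\beta\omega\beta,\quad \zeta'=0,\quad \omega'=\tfrac12(\omega+\zeta)^T\beta(\omega+\zeta)+\tfrac12\frac{\operatorname{tr}\omega\beta\omega\beta}{\operatorname{tr}\beta}I+\tfrac12\frac{\operatorname{tr}\zeta\beta\zeta\beta}{\operatorname{tr}\beta}I.\]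 Write $I_2$ for the $2\times2$ identity, $K_2=\begin{pmatrix}1&0\\0&-1\end{pmatrix}$, $S_2=\begin{pmatrix}0&1\\1&0\end{pmatrix}$, $Z_2=\begin{pmatrix}0&-1\\1&0\end{pmatrix}$, and $\oplus$ for block-diagonal sum. Block diagonal assumption for $n=2m$: there are functions $b_0,b_1,b_2,w_0,w_1,w_2:\mathbb{R}\to\mathbb{R}^m$ and a fixed $z\in\mathbb{R}^m$ with \[\beta=\bigoplus_{i=1}^m(b_{0,i}I_2+b_{1,i}K_2+b_{2,i}S_2),\quad \zeta=\bigoplus_{i=1}^m z_iZ_2,\quad \omega=\bigoplus_{i=1}^m(w_{0,i}I_2+w_{1,i}K_2+w_{2,i}S_2),\] and $b_0\cdot w_0+b_1\cdot w_1+b_2\cdot w_2=0$. *)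

(* Defs.v *)
From HB Require Import structures.
From mathcomp Require Import all_boot all_order all_algebra.
From mathcomp Require Import all_classical all_reals all_analysis.

Set Implicit Arguments.
Unset Strict Implicit.
Unset Printing Implicit Defensive.

Import Order.TTheory GRing.Theory Num.Theory.
Import numFieldNormedType.Exports.

Local Open Scope classical_set_scope.
Local Open Scope ring_scope.

Definition hs_inner (R : realType) (n : nat) (X Y : 'M[R]_n) : R :=
  \tr (X *m Y^T).

Definition hs_norm (R : realType) (n : nat) (X : 'M[R]_n) : R :=
  Num.sqrt (hs_inner X X).

Definition hs_bounded (R : realType) (n : nat) (S : set 'M[R]_n) : Prop :=
  exists C : R, forall X : 'M[R]_n, S X -> hs_norm X <= C.

Definition SL (R : realType) (n : nat) : set 'M[R]_n := [set X | \det X = 1].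

Arguments SL : clear implicits.

(* The geodesic equation of the metric induced on SL(n) by [hs_inner]: the
   acceleration is normal to SL(n), the normal line at X being spanned by
   X^{-T}.  Since SL(n) is closed in the Euclidean space of matrices, the
   metric is complete and maximal geodesics are defined on all of R. *)
Definition is_geodesic (R : realType) (n : nat) (A : R -> 'M[R]_n) : Prop :=
  [/\ forall t, SL R n (A t),
      forall t, derivable A t 1,
      forall t, derivable (derive1 A) t 1 &
      forall t,
        derive1 (derive1 A) t =
        (\tr (derive1 A t *m invmx (A t) *m derive1 A t *m invmx (A t))
          / \tr (invmx (A t) *m (invmx (A t))^T)) *: (invmx (A t))^T].

Definition geo_beta (R : realType) (n : nat) (A : R -> 'M[R]_n) (t : R)
    : 'M[R]_n :=
  invmx (A t) *m (invmx (A t))^T.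

Definition geo_omega (R : realType) (n : nat) (A : R -> 'M[R]_n) (t : R)
    : 'M[R]_n :=
  (A t)^T *m derive1 A t + derive1 (fun s => (A s)^T) t *m A t.

Definition geo_zeta (R : realType) (n : nat) (A : R -> 'M[R]_n) (t : R)
    : 'M[R]_n :=
  (A t)^T *m derive1 A t - derive1 (fun s => (A s)^T) t *m A t.

Definition I2 (R : realType) : 'M[R]_2 := 1%:M.

Definition K2 (R : realType) : 'M[R]_2 :=
  block_mx (1%:M : 'M[R]_1) 0 0 ((-1)%:M : 'M[R]_1).

Definition S2 (R : realType) : 'M[R]_2 :=
  block_mx 0 (1%:M : 'M[R]_1) (1%:M : 'M[R]_1) 0.

Definition Z2 (R : realType) : 'M[R]_2 :=
  block_mx 0 ((-1)%:M : 'M[R]_1) (1%:M : 'M[R]_1) 0.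

Lemma sum_two (m : nat) : (\sum_(i < m) 2 = 2 * m)%N.
Proof. by rewrite sum_nat_const card_ord mulnC. Qed.

(* [\mxdiag] has size [\sum_(i < m) 2]; the cast only renames it [2 * m]. *)
Definition dsum2 (R : realType) (m : nat) (B : 'I_m -> 'M[R]_2)
    : 'M[R]_(2 * m) :=
  castmx (sum_two m, sum_two m) (\mxdiag_(i < m) B i).

Definition dot (R : realType) (m : nat) (u v : 'rV[R]_m) : R :=
  (u *m v^T) 0 0.

Definition block_diagonal_assumption (R : realType) (m : nat)
    (beta omega zeta : R -> 'M[R]_(2 * m))
    (b0 b1 b2 w0 w1 w2 : R -> 'rV[R]_m) (z : 'rV[R]_m) : Prop :=
  forall t : R,
    [/\ beta t = dsum2 (fun i =>
          b0 t 0 i *: I2 R + b1 t 0 i *: K2 R + b2 t 0 i *: S2 R),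
        zeta t = dsum2 (fun i => z 0 i *: Z2 R),
        omega t = dsum2 (fun i =>
          w0 t 0 i *: I2 R + w1 t 0 i *: K2 R + w2 t 0 i *: S2 R) &
        dot (b0 t) (w0 t) + dot (b1 t) (w1 t) + dot (b2 t) (w2 t) = 0].

(* Main.v *)
(* Put G = A^T A.  On the blocks, beta is the inverse of G, G' = omega, and
   A^T A'' is a multiple lambda I of the identity, so that
   omega' = (omega + zeta)^T beta (omega + zeta) / 2 + 2 lambda I.
   In each block the K2 and S2 components of G and omega satisfy a homogeneous
   linear system with continuous coefficients, in which lambda does not occur;
   they vanish at t0, hence always.  Then G is the sum of the g_i I2, with
   g_i' = w_i, w_i' = 2 lambda + (w_i^2 + z_i^2) / (2 g_i) and
   sum_i w_i / g_i = 0.  Thus the energy sum_i (w_i^2 + z_i^2) / g_i and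
   sum_i ln g_i are constant: since z_i <> 0, the energy keeps each g_i away
   from 0, and constancy of the product then bounds each g_i from above. *)
Require Import Defs.
From HB Require Import structures.
From mathcomp Require Import all_boot all_order all_algebra.
From mathcomp Require Import all_classical all_reals all_analysis.
From mathcomp Require Import ring lra.

Set Implicit Arguments.
Unset Strict Implicit.
Unset Printing Implicit Defensive.

Import Order.TTheory GRing.Theory Num.Theory.
Import numFieldNormedType.Exports.

Local Open Scope classical_set_scope.
Local Open Scope ring_scope.

(** * Scalar differential equations *)

Lemma is_derive_continuous (R : realType) (f : R -> R) (t df : R) :
  is_derive t 1 f df -> f x @[x --> t] --> f t.
Proof. by case=> + _ => /derivable1_diffP/differentiable_continuous. Qed.

Lemma is_derive1D (R : realType) (f g : R -> R) (t df dg : R) :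
  is_derive t 1 f df -> is_derive t 1 g dg ->
  is_derive t 1 (fun x => f x + g x) (df + dg).
Proof. exact: is_deriveD. Qed.

Lemma is_derive1M (R : realType) (f g : R -> R) (t df dg : R) :
  is_derive t 1 f df -> is_derive t 1 g dg ->
  is_derive t 1 (fun x => f x * g x) (df * g t + f t * dg).
Proof.
move=> fd gd; apply: is_derive_eq (is_deriveM fd gd) _.
by rewrite /GRing.scale /= addrC (mulrC (g t)).
Qed.

Lemma is_derive1V (R : realType) (f : R -> R) (t df : R) :
  f t != 0 -> is_derive t 1 f df ->
  is_derive t 1 (fun x => (f x)^-1) (- (df / f t ^+ 2)).
Proof.
move=> ft0 [fd fE]; split; first exact: derivableV.
by rewrite deriveV // fE /GRing.scale /= mulNr mulrC.
Qed.

Lemma is_derive1_sum (R : realType) (n : nat) (f : 'I_n -> R -> R)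
    (df : 'I_n -> R) (t : R) :
  (forall i, is_derive t 1 (f i) (df i)) ->
  is_derive t 1 (fun x => \sum_i f i x) (\sum_i df i).
Proof.
move=> fd; have := is_derive_sum fd; congr is_derive.
by apply/funext => x; rewrite fct_sumE.
Qed.

Lemma MVT_everywhere (R : realType) (f df : R -> R) (a b : R) :
  (forall t : R, is_derive t 1 f (df t)) -> a <= b ->
  exists2 c, c \in `[a, b] & f b - f a = df c * (b - a).
Proof.
move=> fdf ab; apply: MVT_segment => //.
apply: continuous_subspaceT => t; exact: is_derive_continuous (fdf t).
Qed.

(** Between [t0] and [t] the coefficient [k] is at most a constant K, so V exp(-K s) is
    nonincreasing and V exp(K s) nondecreasing there. The first gives V <= 0 after [t0], the second
    before it. *)
Lemma gronwall_eq0 (R : realType) (V dV k : R -> R) (t0 : R) :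
  (forall t : R, is_derive t 1 V (dV t)) -> continuous k ->
  (forall t, 0 <= V t) -> (forall t, `|dV t| <= k t * V t) ->
  V t0 = 0 -> forall t, V t = 0.
Proof.
move=> VdV kc V0 dVk Vt0 t; apply/eqP; rewrite eq_le V0 andbT.
have kb a b : a <= b -> exists K, forall s, s \in `[a, b] -> `|dV s| <= K * V s.
  move=> ab; have [c _ kK] := EVT_max ab (continuous_subspaceT kc).
  exists (k c) => s /kK ks; apply: le_trans (dVk s) _.
  exact: ler_wpM2r.
have dE (K s : R) : is_derive s 1 (fun x => V x * expR (K * x))
    ((dV s + K * V s) * expR (K * s)).
  have dK : is_derive s 1 (fun x : R => expR (K * x)) (expR (K * s) * K).
    apply: (@is_derive1_comp _ expR ( *%R K) s _ _ _ _).
    apply: is_derive_eq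
      (is_derive1M (is_derive_cst _ _ _) (is_derive_id _ _)) _.
    by rewrite mul0r add0r mulr1.
  apply: is_derive_eq (is_derive1M (VdV s) dK) _; ring.
have [tt|/ltW tt] := leP t0 t; have [K HK] := kb _ _ tt.
- have [c cab] := MVT_everywhere (dE (- K)) tt.
  rewrite Vt0 mul0r subr0 => E.
  rewrite -(pmulr_lle0 _ (expR_gt0 (- K * t))) E.
  rewrite mulr_le0_ge0 ?subr_ge0 // mulr_le0_ge0 ?expR_ge0 //.
  by have := HK _ cab; rewrite ler_norml => /andP[_]; lra.
- have [c cab] := MVT_everywhere (dE K) tt.
  rewrite Vt0 mul0r sub0r => E.
  rewrite -(pmulr_lle0 _ (expR_gt0 (K * t))) -oppr_ge0 E.
  rewrite mulr_ge0 ?subr_ge0 // mulr_ge0 ?expR_ge0 //.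
  by have := HK _ cab; rewrite ler_norml => /andP[+ _]; lra.
Qed.

(** The squared norm [V] of (x, y, u, v) satisfies |V'| <= k V with [k] continuous, so the Gronwall
    argument makes it vanish identically. *)
Lemma linear_system_eq0 (R : realType) (x y u v : R -> R)
    (a1 a2 a3 a4 c1 c2 c3 c4 : R -> R) (t0 : R) :
  continuous a1 -> continuous a2 -> continuous a3 -> continuous a4 ->
  continuous c1 -> continuous c2 -> continuous c3 -> continuous c4 ->
  (forall t : R, is_derive t 1 x (u t)) ->
  (forall t : R, is_derive t 1 y (v t)) ->
  (forall t : R, is_derive t 1 u
     (a1 t * x t + a2 t * y t + a3 t * u t + a4 t * v t)) ->
  (forall t : R, is_derive t 1 v
     (c1 t * x t + c2 t * y t + c3 t * u t + c4 t * v t)) ->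
  x t0 = 0 -> y t0 = 0 -> u t0 = 0 -> v t0 = 0 ->
  forall t, [/\ x t = 0, y t = 0, u t = 0 & v t = 0].
Proof.
move=> ac1 ac2 ac3 ac4 cc1 cc2 cc3 cc4 dx dy du dv x0 y0 u0 v0.
pose V t := x t * x t + y t * y t + u t * u t + v t * v t.
have Vge0 t : 0 <= V t by rewrite /V !addr_ge0 // -expr2 sqr_ge0.
suff V0 t : V t = 0.
  move=> t; have := V0 t; rewrite /V -!expr2.
  have := (sqr_ge0 (x t), sqr_ge0 (y t), (sqr_ge0 (u t), sqr_ge0 (v t))).
  move=> [[hx hy] [hu hv]] E.
  by split; apply/eqP; rewrite -sqrf_eq0 eq_le ?hx ?hy ?hu ?hv andbT; lra.
(* The outer 2 comes from differentiating squares, the inner 2 from the unit coefficients in x' = u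
   and y' = v; every other coefficient contributes once. *)
pose k t := 2 * (2 + `|a1 t| + `|a2 t| + `|a3 t| + `|a4 t|
                   + `|c1 t| + `|c2 t| + `|c3 t| + `|c4 t|).
pose du' t := a1 t * x t + a2 t * y t + a3 t * u t + a4 t * v t.
pose dv' t := c1 t * x t + c2 t * y t + c3 t * u t + c4 t * v t.
pose dV t := 2 * (u t * x t + v t * y t + du' t * u t + dv' t * v t).
apply: (@gronwall_eq0 _ V dV k t0) => // [s|s|s|].
- apply: is_derive_eq (is_derive1D (is_derive1D
    (is_derive1D (is_derive1M (dx s) (dx s))
      (is_derive1M (dy s) (dy s)))
      (is_derive1M (du s) (du s)))
      (is_derive1M (dv s) (dv s))) _.
  rewrite /dV /du' /dv'; ring.
- apply: cvgM; first exact: cvg_cst.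
  have cvg_abs (f : R -> R) : continuous f ->
      (`|f x| : R) @[x --> s] --> (`|f s| : R).
    by move=> fc; apply: cvg_norm; exact: fc.
  by do 8 (apply: cvgD; last exact: cvg_abs); exact: cvg_cst.
(* Since (p + q)^2 and (p - q)^2 are nonnegative, |p q| <= (p^2 + q^2) / 2 <= V. *)
- have bound a p q : p * p <= V s -> q * q <= V s ->
      - (`|a| * V s) <= a * (p * q) <= `|a| * V s.
    move=> pV qV; rewrite -ler_norml normrM ler_wpM2l // ler_norml.
    have := sqr_ge0 (p + q); have := sqr_ge0 (p - q).
    by rewrite !expr2 => *; apply/andP; split; lra.
  have sq (p : R) : 0 <= p * p by rewrite -expr2 sqr_ge0.
  have [[[hx hy] hu] hv] := (sq (x s), sq (y s), sq (u s), sq (v s)).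
  have xV : x s * x s <= V s by rewrite /V; lra.
  have yV : y s * y s <= V s by rewrite /V; lra.
  have uV : u s * u s <= V s by rewrite /V; lra.
  have vV : v s * v s <= V s by rewrite /V; lra.
  have := (bound 1 _ _ uV xV, bound 1 _ _ vV yV,
    (bound (a1 s) _ _ xV uV, bound (a2 s) _ _ yV uV,
     bound (a3 s) _ _ uV uV, bound (a4 s) _ _ vV uV),
    (bound (c1 s) _ _ xV vV, bound (c2 s) _ _ yV vV,
     bound (c3 s) _ _ uV vV, bound (c4 s) _ _ vV vV)).
  rewrite normr1 => -[[[/andP[? ?] /andP[? ?]]
    [[[/andP[? ?] /andP[? ?]] /andP[? ?]] /andP[? ?]]]
    [[[/andP[? ?] /andP[? ?]] /andP[? ?]] /andP[? ?]]].
  rewrite ler_norml /dV /du' /dv' /k.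
  by apply/andP; split; lra.
- by rewrite /V x0 y0 u0 v0 !mul0r !addr0.
Qed.

(* The right-hand sides for w1 and w2 are the K2 and S2 components of
   (omega + zeta)^T beta (omega + zeta) / 2. *)
Lemma round_block (R : realType) (g0 g1 g2 w0 w1 w2 dw0 b0 b1 b2 : R -> R)
    (z t0 : R) (Delta := fun t => g0 t ^+ 2 - g1 t ^+ 2 - g2 t ^+ 2) :
  (forall t, Delta t != 0) ->
  (forall t, b0 t = g0 t / Delta t) ->
  (forall t, b1 t = - (g1 t / Delta t)) ->
  (forall t, b2 t = - (g2 t / Delta t)) ->
  (forall t : R, is_derive t 1 g0 (w0 t)) ->
  (forall t : R, is_derive t 1 g1 (w1 t)) ->
  (forall t : R, is_derive t 1 g2 (w2 t)) ->
  (forall t : R, is_derive t 1 w0 (dw0 t)) ->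
  (forall t : R, is_derive t 1 w1
     (b0 t * w0 t * w1 t + b0 t * z * w2 t
      + b1 t * (w0 t ^+ 2 + w1 t ^+ 2 - w2 t ^+ 2 - z ^+ 2) / 2
      + b2 t * (w0 t * z + w1 t * w2 t))) ->
  (forall t : R, is_derive t 1 w2
     (b0 t * w0 t * w2 t - b0 t * z * w1 t
      + b1 t * (w1 t * w2 t - w0 t * z)
      + b2 t * (w0 t ^+ 2 - w1 t ^+ 2 + w2 t ^+ 2 - z ^+ 2) / 2)) ->
  g1 t0 = 0 -> g2 t0 = 0 -> w1 t0 = 0 -> w2 t0 = 0 ->
  forall t, [/\ g1 t = 0, g2 t = 0, w1 t = 0 & w2 t = 0].
Proof.
move=> D0 b0E b1E b2E dg0 dg1 dg2 dw0E dw1 dw2.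
have cont (f df : R -> R) : (forall t : R, is_derive t 1 f (df t)) ->
    continuous f.
  by move=> fd t; exact: is_derive_continuous (fd t).
have cM (f g : R -> R) : continuous f -> continuous g ->
    continuous (fun t => f t * g t).
  by move=> fc gc t; apply: cvgM; [exact: fc|exact: gc].
have cD (f g : R -> R) : continuous f -> continuous g ->
    continuous (fun t => f t + g t).
  by move=> fc gc t; apply: cvgD; [exact: fc|exact: gc].
have cN (f : R -> R) : continuous f -> continuous (fun t => - f t).
  by move=> fc t; apply: cvgN; exact: fc.
have cC (c : R) : continuous (fun _ : R => c) by move=> t; exact: cvg_cst.
have [cg0 cg1 cg2] := And3 (cont _ _ dg0) (cont _ _ dg1) (cont _ _ dg2).
have [cw0 cw1 cw2] := And3 (cont _ _ dw0E) (cont _ _ dw1) (cont _ _ dw2).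
pose d t := (Delta t)^-1.
have cd : continuous d.
  move=> t; apply: cvgV => //.
  exact: (cD _ _ (cD _ _ (cM _ _ cg0 cg0) (cN _ (cM _ _ cg1 cg1)))
    (cN _ (cM _ _ cg2 cg2))).
have cb0 : continuous b0 by rewrite (funext b0E); exact: cM cg0 cd.
(* Substituting b1 = - d g1 and b2 = - d g2 gives a system linear in (g1, g2, w1, w2), the factors
   quadratic in w and z being absorbed into the coefficients. Differences and squares are spelled
   out so that [cD], [cN] and [cM] match them. *)
pose a1 t := - (d t * (2^-1 * (w0 t * w0 t + w1 t * w1 t
                               + - (w2 t * w2 t) + - (z * z)))).
pose a2 t := - (d t * (w0 t * z + w1 t * w2 t)).
pose c1 t := - (d t * (w1 t * w2 t + - (w0 t * z))).
pose c2 t := - (d t * (2^-1 * (w0 t * w0 t + - (w1 t * w1 t)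
                               + w2 t * w2 t + - (z * z)))).
pose a3 t := b0 t * w0 t.
pose a4 t := b0 t * z.
pose c3 t := - (b0 t * z).
have ca1 : continuous a1.
  exact: (cN _ (cM _ _ cd (cM _ _ (cC _) (cD _ _ (cD _ _ (cD _ _
    (cM _ _ cw0 cw0) (cM _ _ cw1 cw1)) (cN _ (cM _ _ cw2 cw2))) (cC _))))).
have ca2 : continuous a2.
  exact: (cN _ (cM _ _ cd (cD _ _ (cM _ _ cw0 (cC _)) (cM _ _ cw1 cw2)))).
have cc1 : continuous c1.
  exact: (cN _ (cM _ _ cd (cD _ _ (cM _ _ cw1 cw2)
    (cN _ (cM _ _ cw0 (cC _)))))).
have cc2 : continuous c2.
  exact: (cN _ (cM _ _ cd (cM _ _ (cC _) (cD _ _ (cD _ _ (cD _ _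
    (cM _ _ cw0 cw0) (cN _ (cM _ _ cw1 cw1))) (cM _ _ cw2 cw2)) (cC _))))).
have ca3 : continuous a3 by exact: cM cb0 cw0.
have ca4 : continuous a4 by exact: cM cb0 (cC z).
have cc3 : continuous c3 by exact: cN _ ca4.
have du (t : R) : is_derive t 1 w1
    (a1 t * g1 t + a2 t * g2 t + a3 t * w1 t + a4 t * w2 t).
  apply: is_derive_eq (dw1 t) _.
  by rewrite b1E b2E /a1 /a2 /a3 /a4 /d; field.
have dv (t : R) : is_derive t 1 w2
    (c1 t * g1 t + c2 t * g2 t + c3 t * w1 t + a3 t * w2 t).
  apply: is_derive_eq (dw2 t) _.
  by rewrite b1E b2E /c1 /c2 /c3 /a3 /d; field.
exact: (linear_system_eq0 ca1 ca2 ca3 ca4 cc1 cc2 cc3 ca3 dg1 dg2 du dv).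
Qed.

(** The equation for w_i reduces the derivative of (w_i^2 + z_i^2) / g_i to 2 lam w_i / g_i, and
    that of ln g_i is w_i / g_i; summed over i, both vanish. *)
Lemma bounded_round (R : realType) (m : nat) (g w : 'I_m -> R -> R)
    (z : 'I_m -> R) (lam : R -> R) :
  (forall i t, 0 < g i t) -> (forall i, z i != 0) ->
  (forall i (t : R), is_derive t 1 (g i) (w i t)) ->
  (forall i (t : R), is_derive t 1 (w i)
     (lam t + (w i t ^+ 2 + z i ^+ 2) / (2 * g i t))) ->
  (forall t, \sum_i w i t / g i t = 0) ->
  exists C, forall i t, g i t <= C.
Proof.
move=> g0 z0 dg dw sum0.
have constP (f : R -> R) : (forall t : R, is_derive t 1 f 0) ->
    forall t, f t = f 0.
  by move=> fd t; exact: is_derive_0_is_cst.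
pose E t := \sum_i (w i t * w i t + z i ^+ 2) * (g i t)^-1.
have dE i (s : R) : is_derive s 1
    (fun t => (w i t * w i t + z i ^+ 2) * (g i t)^-1)
    (2 * lam s * (w i s / g i s)).
  apply: is_derive_eq (is_derive1M (is_derive1D (is_derive1M (dw i s) (dw i s))
    (is_derive_cst (z i ^+ 2) s 1))
    (is_derive1V (lt0r_neq0 (g0 i s)) (dg i s))) _.
  by have gn0 := lt0r_neq0 (g0 i s); rewrite /=; field.
have EC t : E t = E 0.
  apply: (constP E) => u.
  apply: is_derive_eq (is_derive1_sum (fun i => dE i u)) _.
  by rewrite -mulr_sumr sum0 mulr0.
have term_ge0 i t : 0 <= (w i t * w i t + z i ^+ 2) * (g i t)^-1.
  by rewrite mulr_ge0 ?invr_ge0 ?(ltW (g0 i t)) // -expr2 addr_ge0 ?sqr_ge0.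
(* All terms of the energy are nonnegative, so its constant value bounds the i-th one, and with it
   z_i^2 / g_i. *)
have zE i t : z i ^+ 2 <= E 0 * g i t.
  rewrite -(EC t) -ler_pdivrMr // /E (bigD1 i) //=.
  rewrite -[leLHS]addr0 lerD ?sumr_ge0 //.
  by rewrite ler_pM2r ?invr_gt0 // lerDr -expr2 sqr_ge0.
have z2 i : 0 < z i ^+ 2 by rewrite exprn_even_gt0 /=.
(* Positivity is claimed only in the presence of an index: for m = 0 the energy is an empty sum. *)
have E0 (i : 'I_m) : 0 < E 0.
  by rewrite -(pmulr_lgt0 _ (g0 i 0)) (lt_le_trans (z2 i)).
pose l i := ln (z i ^+ 2 / E 0).
have l_le i t : l i <= ln (g i t).
  rewrite ler_ln ?posrE ?divr_gt0 ?(E0 i) //.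
  by rewrite ler_pdivrMr ?(E0 i) // mulrC.
pose L t := \sum_i ln (g i t).
have dL i (s : R) : is_derive s 1 (fun t => ln (g i t)) (w i s / g i s).
  rewrite mulrC; exact: is_derive1_comp (is_derive1_ln (g0 i s)) (dg i s).
have LC t : L t = L 0.
  apply: (constP L) => u.
  apply: is_derive_eq (is_derive1_sum (fun i => dL i u)) _.
  exact: sum0.
(* Constancy of [L] gives ln g_i = L 0 - sum_{j <> i} ln g_j <= L 0 - sum_{j <> i} l_j; adding the
   exponentials yields one bound valid for all i. *)
exists (\sum_i expR (L 0 - \sum_(j | j != i) l j)) => i t.
apply: (@le_trans _ _ (expR (L 0 - \sum_(j | j != i) l j))); last first.
  by rewrite [leRHS](bigD1 i) //= lerDl sumr_ge0 // => j _; exact: expR_ge0.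
rewrite -[leLHS]lnK ?posrE // ler_expR -(LC t) /L (bigD1 i) //=.
rewrite -addrA lerDl subr_ge0.
exact: ler_sum.
Qed.

(** * Matrix-valued functions and 2x2 diagonal blocks *)

Lemma is_derive_mxP (R : realType) (m n : nat) (F : R -> 'M[R]_(m, n))
    (t : R) (D : 'M[R]_(m, n)) :
  is_derive t 1 F D <->
  forall i j, is_derive t 1 (fun s => F s i j) (D i j).
Proof.
split=> [[dF <-] i j|dF].
  have /derivable_mxP/(_ i j) dij := dF.
  by split=> //; rewrite derive_mx // mxE.
have dF' : derivable F t 1 by apply/derivable_mxP => i j; case: (dF i j).
split=> //; apply/matrixP => i j.
by rewrite derive_mx // mxE; case: (dF i j).
Qed.

Lemma is_derive_mulmx (R : realType) (m n p : nat) (F : R -> 'M[R]_(m, n))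
    (G : R -> 'M[R]_(n, p)) (t : R) (DF : 'M[R]_(m, n)) (DG : 'M[R]_(n, p)) :
  is_derive t 1 F DF -> is_derive t 1 G DG ->
  is_derive t 1 (fun s => F s *m G s) (DF *m G t + F t *m DG).
Proof.
move=> /is_derive_mxP dF /is_derive_mxP dG; apply/is_derive_mxP => i j.
rewrite (_ : (fun s => _) = fun s => \sum_k F s i k * G s k j); last first.
  by apply/funext => s; rewrite mxE.
have := is_derive1_sum (fun k => is_derive1M (dF i k) (dG k j)).
by move=> /is_derive_eq; apply; rewrite !mxE big_split.
Qed.

Lemma is_derive_trmx (R : realType) (m n : nat) (F : R -> 'M[R]_(m, n))
    (t : R) (D : 'M[R]_(m, n)) :
  is_derive t 1 F D -> is_derive t 1 (fun s => (F s)^T) D^T.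
Proof.
move=> /is_derive_mxP dF; apply/is_derive_mxP => i j; rewrite mxE.
rewrite (_ : (fun s => _) = fun s => F s j i) //.
by apply/funext => s; rewrite mxE.
Qed.

(** [tagnat.Rank] is the numbering of pairs (block, position) underlying [\mxdiag]; the cast is the
    one in [dsum2]. *)
Definition dindex (m : nat) (i : 'I_m) (a : 'I_2) : 'I_(2 * m) :=
  cast_ord (sum_two m) (tagnat.Rank i a).

Definition dblock (R : realType) (m : nat) (i : 'I_m) (X : 'M[R]_(2 * m)) :
    'M[R]_2 :=
  mxsub (dindex i) (dindex i) X.

(** Undoing the cast gives access to the theory of [submxblock] and [\mxdiag], which lives on
    matrices of size [\sum_(i < m) 2]. *)
Lemma castmx_dblockP (R : realType) (m : nat) (X : 'M[R]_(2 * m)) :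
  exists2 Y, X = castmx (sum_two m, sum_two m) Y &
    forall i, dblock i X = submxblock Y i i.
Proof.
exists (castmx (esym (sum_two m), esym (sum_two m)) X).
  by rewrite castmx_comp castmx_id.
move=> i; apply/matrixP => a b; rewrite !mxE castmxE.
by congr (X _ _); apply: val_inj.
Qed.

Lemma castmx_mulmx (R : realType) (n p : nat) (e : n = p) (X Y : 'M[R]_n) :
  castmx (e, e) X *m castmx (e, e) Y = castmx (e, e) (X *m Y).
Proof. by case: _ / e. Qed.

Lemma mxtrace_castmx (R : realType) (n p : nat) (e : n = p) (X : 'M[R]_n) :
  \tr (castmx (e, e) X) = \tr X.
Proof. by case: _ / e. Qed.

Lemma dblock_dsum2 (R : realType) (m : nat) (B : 'I_m -> 'M[R]_2) (i : 'I_m) :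
  dblock i (dsum2 B) = B i.
Proof.
have [Y /(congr1 (castmx (esym (sum_two m), esym (sum_two m))))] :=
  castmx_dblockP (dsum2 B).
by rewrite !castmxK => <- ->; exact: submxblock_diag.
Qed.

(** A block-diagonal left factor acts on each block row separately, so [X] may be arbitrary; in
    particular the Gram matrix need not be shown to be block diagonal. *)
Lemma dblock_dsum2_mul (R : realType) (m : nat) (B : 'I_m -> 'M[R]_2)
    (X : 'M[R]_(2 * m)) (i : 'I_m) :
  dblock i (dsum2 B *m X) = B i *m dblock i X.
Proof.
have [Y XE XY] := castmx_dblockP X; rewrite XY XE /dsum2 castmx_mulmx.
have [Z /(congr1 (castmx (esym (sum_two m), esym (sum_two m))))] :=
  castmx_dblockP (castmx (sum_two m, sum_two m) (\mxdiag_j B j *m Y)).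
rewrite !castmxK => <- ->.
by rewrite -{1}[Y]submxblockK mul_mxdiag_mxblock mxblockK.
Qed.

Lemma dblockD (R : realType) (m : nat) (i : 'I_m) (X Y : 'M[R]_(2 * m)) :
  dblock i (X + Y) = dblock i X + dblock i Y.
Proof. by apply/matrixP => a b; rewrite !mxE. Qed.

Lemma dblockB (R : realType) (m : nat) (i : 'I_m) (X Y : 'M[R]_(2 * m)) :
  dblock i (X - Y) = dblock i X - dblock i Y.
Proof. by apply/matrixP => a b; rewrite !mxE. Qed.

Lemma dblockZ (R : realType) (m : nat) (i : 'I_m) (c : R) (X : 'M[R]_(2 * m)) :
  dblock i (c *: X) = c *: dblock i X.
Proof. by apply/matrixP => a b; rewrite !mxE. Qed.

Lemma dblock_scalar (R : realType) (m : nat) (i : 'I_m) (c : R) :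
  dblock i (c%:M : 'M[R]_(2 * m)) = c%:M.
Proof.
apply/matrixP => a b; rewrite !mxE; congr (_ *+ _); congr nat_of_bool.
by rewrite -!val_eqE /= tagnat.eq_Rank eqxx.
Qed.

Lemma mxtrace_dblock (R : realType) (m : nat) (X : 'M[R]_(2 * m)) :
  \tr X = \sum_i \tr (dblock i X).
Proof.
have [Y XE XY] := castmx_dblockP X.
transitivity (\sum_i \tr (submxblock Y i i)); last first.
  by apply: eq_bigr => i _; rewrite XY.
by rewrite XE mxtrace_castmx -{1}[Y]submxblockK mxtrace_mxblock.
Qed.

Lemma is_derive_dblock (R : realType) (m : nat) (i : 'I_m)
    (F : R -> 'M[R]_(2 * m)) (t : R) (D : 'M[R]_(2 * m)) :
  is_derive t 1 F D ->
  forall a b, is_derive t 1 (fun s => dblock i (F s) a b) (dblock i D a b).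
Proof.
move=> /is_derive_mxP dF a b; rewrite mxE.
rewrite (_ : (fun s => _) = fun s => F s (dindex i a) (dindex i b)) //.
by apply/funext => s; rewrite mxE.
Qed.

(** * Entries and inverses of 2x2 matrices *)

Lemma mulmx2E (R : pzSemiRingType) (X Y : 'M[R]_2) (a b : 'I_2) :
  (X *m Y) a b = X a 0 * Y 0 b + X a 1 * Y 1 b.
Proof.
rewrite mxE big_ord_recl big_ord1; congr (_ + X a _ * Y _ b); exact: val_inj.
Qed.

Lemma block_mx2E (R : Type) (a b c d : 'M[R]_1)
    (X := block_mx a b c d : 'M[R]_2) :
  [/\ X 0 0 = a 0 0, X 0 1 = b 0 0, X 1 0 = c 0 0 & X 1 1 = d 0 0].
Proof.
split; [rewrite -(block_mxEul a b c d) | rewrite -(block_mxEur a b c d)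
       | rewrite -(block_mxEdl a b c d) | rewrite -(block_mxEdr a b c d)];
  by congr (block_mx a b c d _ _); exact: val_inj.
Qed.

Lemma I2K2S2E (R : realType) (c0 c1 c2 : R)
    (X := c0 *: I2 R + c1 *: K2 R + c2 *: S2 R) :
  [/\ X 0 0 = c0 + c1, X 0 1 = c2, X 1 0 = c2 & X 1 1 = c0 - c1].
Proof.
have XE a b : X a b = c0 * (a == b)%:R + c1 * K2 R a b + c2 * S2 R a b.
  rewrite [LHS]mxE; congr (_ + _); last by rewrite [LHS]mxE.
  rewrite [LHS]mxE; congr (_ + _); last by rewrite [LHS]mxE.
  by rewrite [LHS]mxE /I2 [X in _ * X]mxE.
rewrite !XE.
have [-> -> -> ->] := block_mx2E (1%:M : 'M[R]_1) 0 0 (-1)%:M.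
have [-> -> -> ->] := block_mx2E 0 (1%:M : 'M[R]_1) 1%:M 0.
by rewrite !mxE /=; split; ring.
Qed.

Lemma Z2E (R : realType) (c : R) (X := c *: Z2 R) :
  [/\ X 0 0 = 0, X 0 1 = - c, X 1 0 = c & X 1 1 = 0].
Proof.
have XE a b : X a b = c * Z2 R a b by rewrite [LHS]mxE.
rewrite !XE.
have [-> -> -> ->] := block_mx2E 0 ((-1)%:M : 'M[R]_1) 1%:M 0.
by rewrite !mxE /=; split; ring.
Qed.

(** Cramer's rule: the hypotheses are the entries of the product of the symmetric matrices (e f; f
    h) and (p q; q r), which is the identity. Their determinants multiply to 1, so D is nonzero. *)
Lemma inv2E (F : fieldType) (e f h p q r : F) (D := p * r - q * q) :
  e * p + f * q = 1 -> e * q + f * r = 0 ->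
  f * p + h * q = 0 -> f * q + h * r = 1 ->
  [/\ D != 0, e = r / D, f = - (q / D) & h = p / D].
Proof.
move=> h1 h2 h3 h4.
have D1 : (e * h - f * f) * D = 1.
  transitivity ((e * p + f * q) * (f * q + h * r)
                - (e * q + f * r) * (f * p + h * q)); first by rewrite /D; ring.
  by rewrite h1 h2 h4 mul0r subr0 mulr1.
have D0 : D != 0.
  by apply/eqP => D0; move/eqP: D1; rewrite D0 mulr0 eq_sym oner_eq0.
split=> //; apply: (mulIf D0); rewrite ?mulNr divfK //.
- transitivity ((e * p + f * q) * r - (e * q + f * r) * q).
    by rewrite /D; ring.
  by rewrite h1 h2; ring.
- transitivity ((f * p + h * q) * r - (f * q + h * r) * q).
    by rewrite /D; ring.
  by rewrite h3 h4; ring.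
- transitivity ((f * q + h * r) * p - (f * p + h * q) * q).
    by rewrite /D; ring.
  by rewrite h3 h4; ring.
Qed.

(** * The geodesic equation in blocks *)

Lemma derivable_is_derive1 (R : realType) (V : normedModType R) (f : R -> V)
    (t : R) :
  derivable f t 1 -> is_derive t 1 f (derive1 f t).
Proof. by move=> df; split=> //; rewrite derive1E. Qed.

Lemma derive1_trmx (R : realType) (m n : nat) (F : R -> 'M[R]_(m, n)) (t : R) :
  derivable F t 1 -> derive1 (fun s => (F s)^T) t = (derive1 F t)^T.
Proof.
move=> /derivable_is_derive1/is_derive_trmx[_ <-].
by rewrite derive1E.
Qed.

Lemma geo_omegaE (R : realType) (n : nat) (A : R -> 'M[R]_n) (t : R) :
  is_geodesic A ->
  geo_omega A t = (A t)^T *m derive1 A t + (derive1 A t)^T *m A t.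
Proof. by case=> _ dA _ _; rewrite /geo_omega derive1_trmx. Qed.

Lemma geo_zetaE (R : realType) (n : nat) (A : R -> 'M[R]_n) (t : R) :
  is_geodesic A ->
  geo_zeta A t = (A t)^T *m derive1 A t - (derive1 A t)^T *m A t.
Proof. by case=> _ dA _ _; rewrite /geo_zeta derive1_trmx. Qed.

Lemma geodesic_unitmx (R : realType) (n : nat) (A : R -> 'M[R]_n) (t : R) :
  is_geodesic A -> A t \in unitmx.
Proof. by case=> detA _ _ _; rewrite unitmxE (detA t) unitr1. Qed.

Lemma geo_beta_gram (R : realType) (n : nat) (A : R -> 'M[R]_n) (t : R) :
  is_geodesic A -> geo_beta A t *m ((A t)^T *m A t) = 1%:M.
Proof.
move=> gA; have uA := geodesic_unitmx t gA.
rewrite /geo_beta mulmxA -(mulmxA (invmx _)) -trmx_mul mulmxV // trmx1 mulmx1.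
exact: mulVmx.
Qed.

Lemma is_derive_gram (R : realType) (n : nat) (A : R -> 'M[R]_n) (t : R) :
  is_geodesic A ->
  is_derive t 1 (fun s => (A s)^T *m A s) (geo_omega A t).
Proof.
move=> gA; rewrite geo_omegaE // addrC.
have [_ /(_ t)/derivable_is_derive1 dA _ _] := gA.
exact: is_derive_mulmx (is_derive_trmx dA) dA.
Qed.

(** Here omega + zeta = 2 A^T A' and omega - zeta is its transpose, so the quadratic term equals 2
    A'^T A'. The rest of omega' is A^T A'' + A''^T A, scalar by the geodesic equation. *)
Lemma is_derive_geo_omega (R : realType) (n : nat) (A : R -> 'M[R]_n) :
  is_geodesic A -> exists lam : R -> R, forall t : R,
  is_derive t 1 (geo_omega A)
    (2^-1 *: ((geo_omega A t - geo_zeta A t)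
              *m (geo_beta A t *m (geo_omega A t + geo_zeta A t)))
     + (lam t)%:M).
Proof.
move=> gA; have [_ dA ddA geoE] := gA.
pose mu t := \tr (derive1 A t *m invmx (A t) *m derive1 A t *m invmx (A t))
          / \tr (invmx (A t) *m (invmx (A t))^T).
(* A^T A'' = mu I, and its transpose contributes the same multiple once more. *)
exists (fun t => mu t + mu t) => t.
have uA := geodesic_unitmx t gA.
have d1 := derivable_is_derive1 (dA t).
have d2 := derivable_is_derive1 (ddA t).
have d3 := is_deriveD (is_derive_mulmx (is_derive_trmx d1) d2)
  (is_derive_mulmx (is_derive_trmx d2) d1).
rewrite [X in is_derive _ _ X _](_ : _ = (fun s => (A s)^T *m derive1 A s)
    + (fun s => (derive1 A s)^T *m A s)); last first.
  by apply/funext => s; rewrite geo_omegaE.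
apply: is_derive_eq d3 _.
rewrite (geo_omegaE t gA) (geo_zetaE t gA) geoE -/(mu t).
set X := A t; set Y := derive1 A t.
have -> : X^T *m Y + Y^T *m X - (X^T *m Y - Y^T *m X) = 2 *: (Y^T *m X).
  by rewrite opprB addrC addrA subrK scaler_nat mulr2n.
have -> : X^T *m Y + Y^T *m X + (X^T *m Y - Y^T *m X) = 2 *: (X^T *m Y).
  by rewrite addrACA subrr addr0 scaler_nat mulr2n.
have -> : geo_beta A t *m (2 *: (X^T *m Y)) = 2 *: (invmx X *m Y).
  rewrite -scalemxAr /geo_beta -/X mulmxA -(mulmxA (invmx X)) -trmx_mul.
  by rewrite mulmxV // trmx1 mulmx1.
have -> : 2 *: (Y^T *m X) *m (2 *: (invmx X *m Y)) = 4 *: (Y^T *m Y).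
  rewrite -scalemxAl -scalemxAr scalerA mulmxA -(mulmxA Y^T) mulmxV // mulmx1.
  by congr (_ *: _); ring.
have trZ (c : R) (M : 'M[R]_n) : (c *: M)^T = c *: M^T.
  by apply/matrixP => i j; rewrite !mxE.
rewrite scalerA trZ trmxK -scalemxAl -scalemxAr mulVmx //.
rewrite -trmx_mul mulVmx // trmx1 !scalemx1 raddfD /=.
rewrite (_ : 2^-1 * 4 = 2 :> R); last by field.
by rewrite scaler_nat mulr2n [in RHS]addrACA; congr (_ + _); rewrite addrC.
Qed.

(** The functions g0, g1, g2 are the [I2], [K2], [S2] coordinates of the diagonal blocks of A^T A.
    The identities beta A^T A = I and (A^T A)' = omega and the formula for omega' are read on these
    blocks; the trace formula later gives the norm of A. *)
Lemma geodesic_block_system (R : realType) (m : nat) (A : R -> 'M[R]_(2 * m))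
    (b0 b1 b2 w0 w1 w2 : R -> 'rV[R]_m) (z : 'rV[R]_m) :
  is_geodesic A ->
  block_diagonal_assumption (geo_beta A) (geo_omega A) (geo_zeta A)
    b0 b1 b2 w0 w1 w2 z ->
  exists (g0 g1 g2 : 'I_m -> R -> R) (lam : R -> R),
  [/\ forall i t, 0 <= g0 i t,
      forall t, \tr ((A t)^T *m A t) = \sum_i 2 * g0 i t,
      forall i t, let D := g0 i t ^+ 2 - g1 i t ^+ 2 - g2 i t ^+ 2 in
        [/\ D != 0, b0 t 0 i = g0 i t / D,
            b1 t 0 i = - (g1 i t / D) & b2 t 0 i = - (g2 i t / D)],
      forall i (t : R), [/\ is_derive t 1 (g0 i) (w0 t 0 i),
        is_derive t 1 (g1 i) (w1 t 0 i) & is_derive t 1 (g2 i) (w2 t 0 i)] &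
      forall i (t : R),
      let z := z 0 i in
      let: (b0, b1, b2) := (b0 t 0 i, b1 t 0 i, b2 t 0 i) in
      let: (v0, v1, v2) := (w0 t 0 i, w1 t 0 i, w2 t 0 i) in
      [/\ is_derive t 1 (fun s => w0 s 0 i)
            (lam t + (b0 * (v0 ^+ 2 + v1 ^+ 2 + v2 ^+ 2 + z ^+ 2) / 2
                      + b1 * (v0 * v1 - z * v2) + b2 * (v0 * v2 + z * v1))),
          is_derive t 1 (fun s => w1 s 0 i)
            (b0 * v0 * v1 + b0 * z * v2
             + b1 * (v0 ^+ 2 + v1 ^+ 2 - v2 ^+ 2 - z ^+ 2) / 2
             + b2 * (v0 * z + v1 * v2)) &
          is_derive t 1 (fun s => w2 s 0 i)
            (b0 * v0 * v2 - b0 * z * v1 + b1 * (v1 * v2 - v0 * z)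
             + b2 * (v0 ^+ 2 - v1 ^+ 2 + v2 ^+ 2 - z ^+ 2) / 2)]].
Proof.
move=> gA hb.
pose G i t := dblock i ((A t)^T *m A t).
pose B i t := b0 t 0 i *: I2 R + b1 t 0 i *: K2 R + b2 t 0 i *: S2 R.
pose W i t := w0 t 0 i *: I2 R + w1 t 0 i *: K2 R + w2 t 0 i *: S2 R.
pose Z i := z 0 i *: Z2 R.
have betaE t : geo_beta A t = dsum2 (B^~ t) by case: (hb t).
have omegaE t : geo_omega A t = dsum2 (W^~ t) by case: (hb t).
have zetaE t : geo_zeta A t = dsum2 Z by case: (hb t).
have GC i t : G i t 1 0 = G i t 0 1.
  by rewrite !mxE; apply: eq_bigr => k _; rewrite !mxE mulrC.
have G_ge0 i t a : 0 <= G i t a a.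
  by rewrite !mxE sumr_ge0 // => k _; rewrite !mxE -expr2 sqr_ge0.
have BG i t : B i t *m G i t = 1%:M.
  rewrite -(dblock_dsum2_mul (B^~ t)) -betaE geo_beta_gram //.
  exact: dblock_scalar.
have dG i (t : R) a b : is_derive t 1 (fun s => G i s a b) (W i t a b).
  have := is_derive_dblock i (is_derive_gram t gA) a b.
  by rewrite omegaE dblock_dsum2.
have [lam domega] := is_derive_geo_omega gA.
have dW i (t : R) a b : is_derive t 1 (fun s => W i s a b)
    (2^-1 * ((W i t - Z i) *m (B i t *m (W i t + Z i))) a b
     + lam t *+ (a == b)).
  have := is_derive_dblock i (domega t) a b.
  rewrite (_ : (fun s => dblock i (geo_omega A s) a b) = fun s => W i s a b);
    last by apply/funext => s; rewrite omegaE dblock_dsum2.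
  (* The triple product is peeled from the left, one block-diagonal factor at a time. *)
  have QE : dblock i (geo_beta A t *m (geo_omega A t + geo_zeta A t))
      = B i t *m (W i t + Z i).
    by rewrite betaE dblock_dsum2_mul dblockD omegaE zetaE !dblock_dsum2.
  rewrite dblockD dblockZ dblock_scalar mulmxBl dblockB.
  set Q := _ *m (_ + _) in QE *.
  rewrite omegaE zetaE !dblock_dsum2_mul QE -mulmxBl => /is_derive_eq; apply.
  by rewrite [LHS]mxE; congr (_ + _); rewrite [LHS]mxE.
(* The coordinates of a symmetric 2x2 matrix are the half-sum and half-difference of its diagonal
   entries and its off-diagonal entry. *)
exists (fun i t => 2^-1 * (G i t 0 0 + G i t 1 1)).
exists (fun i t => 2^-1 * (G i t 0 0 + - G i t 1 1)).
exists (fun i t => G i t 0 1), lam.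
have WE i t := I2K2S2E (w0 t 0 i) (w1 t 0 i) (w2 t 0 i).
have wE i t : [/\ w0 t 0 i = 2^-1 * (W i t 0 0 + W i t 1 1),
    w1 t 0 i = 2^-1 * (W i t 0 0 + - W i t 1 1) & w2 t 0 i = W i t 0 1].
  by rewrite /W; have [-> -> _ ->] := WE i t; split; field.
have half (f : R -> R) (df t : R) : is_derive t 1 f df ->
    is_derive t 1 (fun s => 2^-1 * f s) (2^-1 * df).
  move=> fd.
  apply: is_derive_eq (is_derive1M (is_derive_cst (2^-1 : R) t 1) fd) _.
  by rewrite mul0r add0r.
have neg (f : R -> R) (df t : R) : is_derive t 1 f df ->
    is_derive t 1 (fun s => - f s) (- df).
  exact: is_deriveN.
split=> [i t|t|i t D|i t|i t /=].
- by rewrite mulr_ge0 ?invr_ge0 ?addr_ge0.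
- rewrite mxtrace_dblock; apply: eq_bigr => i _.
  by rewrite /mxtrace big_ord_recl big_ord1 mulrA divff ?mul1r ?pnatr_eq0 //;
     congr (_ + dblock _ _ _ _); exact: val_inj.
- have E a b : B i t a 0 * G i t 0 b + B i t a 1 * G i t 1 b = (a == b)%:R.
    by rewrite -mulmx2E BG mxE.
  have := (E 0 0, E 0 1, (E 1 0, E 1 1)); rewrite /B.
  have [-> -> -> ->] := I2K2S2E (b0 t 0 i) (b1 t 0 i) (b2 t 0 i).
  rewrite GC /= => -[[h1 h2] [h3 h4]].
  have [D0 eE fE hE] := inv2E h1 h2 h3 h4.
  (* In these coordinates [D] is the determinant of the Gram block. *)
  have -> : D = G i t 0 0 * G i t 1 1 - G i t 0 1 * G i t 0 1.
    by rewrite /D; field.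
  split=> //.
  + rewrite -[LHS](mulKf (_ : 2 != 0)) //.
    rewrite (_ : 2 * _ = b0 t 0 i + b1 t 0 i + (b0 t 0 i - b1 t 0 i));
      last by ring.
    by rewrite eE hE; field.
  + rewrite -[LHS](mulKf (_ : 2 != 0)) //.
    rewrite (_ : 2 * _ = b0 t 0 i + b1 t 0 i - (b0 t 0 i - b1 t 0 i));
      last by ring.
    by rewrite eE hE; field.
- have [-> -> ->] := wE i t; split; last exact: dG.
    exact: half (is_derive1D (dG _ _ _ _) (dG _ _ _ _)).
  exact: half (is_derive1D (dG _ _ _ _) (neg _ _ _ (dG _ _ _ _))).
- have w0E : (fun s => w0 s 0 i) = fun s => 2^-1 * (W i s 0 0 + W i s 1 1).
    by apply/funext => s; have [] := wE i s.
  have w1E : (fun s => w1 s 0 i) = fun s => 2^-1 * (W i s 0 0 + - W i s 1 1).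
    by apply/funext => s; have [] := wE i s.
  have w2E : (fun s => w2 s 0 i) = fun s => W i s 0 1.
    by apply/funext => s; have [] := wE i s.
  have quadE (X Y N : 'M[R]_2) a b : ((X - N) *m (Y *m (X + N))) a b
      = (X a 0 - N a 0) * (Y 0 0 * (X 0 b + N 0 b) + Y 0 1 * (X 1 b + N 1 b))
      + (X a 1 - N a 1) * (Y 1 0 * (X 0 b + N 0 b) + Y 1 1 * (X 1 b + N 1 b)).
    by rewrite !mulmx2E !mxE.
  rewrite w0E w1E w2E.
  (* The term [lam] sits on the diagonal only: it survives in the half-sum, cancels in the
     half-difference and is absent from the off-diagonal entry. *)
  split; [apply: is_derive_eq
        (half _ _ _ (is_derive1D (dW _ _ _ _) (dW _ _ _ _))) _
    | apply: is_derive_eq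
        (half _ _ _ (is_derive1D (dW _ _ _ _) (neg _ _ _ (dW _ _ _ _)))) _
    | apply: is_derive_eq (dW _ _ _ _) _];
  rewrite !quadE /W /Z /B;
  have [E1 E2 E3 E4] := WE i t; rewrite ?E1 ?E2 ?E3 ?E4;
  have [F1 F2 F3 F4] := Z2E (z 0 i); rewrite ?F1 ?F2 ?F3 ?F4;
  have [-> -> -> ->] := I2K2S2E (b0 t 0 i) (b1 t 0 i) (b2 t 0 i);
  by rewrite ?eqxx /= ?mulr1n ?mulr0n; field.
Qed.

(** * Boundedness of the geodesic *)

Theorem theorem5p6 (R : realType) (m : nat) (A : R -> 'M[R]_(2 * m))
    (b0 b1 b2 w0 w1 w2 : R -> 'rV[R]_m) (z : 'rV[R]_m)
    (hA : is_geodesic A)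
    (hblock : block_diagonal_assumption
                (geo_beta A) (geo_omega A) (geo_zeta A)
                b0 b1 b2 w0 w1 w2 z)
    (hzero : exists t0 : R,
        [/\ b1 t0 = 0, w1 t0 = 0, b2 t0 = 0 & w2 t0 = 0])
    (hz : forall i : 'I_m, z 0 i != 0) :
  hs_bounded (range A).
Proof.
have [g0 [g1 [g2 [lam [g0_ge0 trE bE dg dw]]]]] :=
  geodesic_block_system hA hblock.
pose D i t := g0 i t ^+ 2 - g1 i t ^+ 2 - g2 i t ^+ 2.
have [t0 [b1t0 w1t0 b2t0 w2t0]] := hzero.
have round i t : [/\ g1 i t = 0, g2 i t = 0, w1 t 0 i = 0 & w2 t 0 i = 0].
  have [D0 _ b1E b2E] := bE i t0.
  (* The data at [t0] concern beta; since b1 = - g1 / D and b2 = - g2 / D, they pass to the Gram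
     block. *)
  have zeroE x : 0 = - (x / D i t0) -> x = 0.
    by move/eqP; rewrite eq_sym oppr_eq0 mulf_eq0 invr_eq0 (negbTE D0) orbF =>
      /eqP.
  apply: (@round_block _ (g0 i) (g1 i) (g2 i) (fun s => w0 s 0 i)
    (fun s => w1 s 0 i) (fun s => w2 s 0 i) _ (fun s => b0 s 0 i)
    (fun s => b1 s 0 i) (fun s => b2 s 0 i) (z 0 i) t0).
  - by move=> s; have [] := bE i s.
  - by move=> s; have [] := bE i s.
  - by move=> s; have [] := bE i s.
  - by move=> s; have [] := bE i s.
  - by move=> s; have [] := dg i s.
  - by move=> s; have [] := dg i s.
  - by move=> s; have [] := dg i s.
  - by move=> s; have [h _ _] := dw i s; exact: h.
  - by move=> s; have [] := dw i s.
  - by move=> s; have [] := dw i s.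
  - by apply: zeroE; rewrite -b1E b1t0 mxE.
  - by apply: zeroE; rewrite -b2E b2t0 mxE.
  - by rewrite w1t0 mxE.
  - by rewrite w2t0 mxE.
(* With g1 = g2 = 0 the nonzero determinant is g0^2, which excludes g0 = 0. *)
have g0_gt0 i t : 0 < g0 i t.
  rewrite lt_neqAle g0_ge0 andbT eq_sym; apply/eqP => g00.
  have [+ _ _ _] := bE i t; have [g10 g20 _ _] := round i t.
  by rewrite /D g00 g10 g20 expr0n subrr subrr eqxx.
have b012 i t : [/\ b0 t 0 i = (g0 i t)^-1, b1 t 0 i = 0 & b2 t 0 i = 0].
  have [_ -> -> ->] := bE i t; have [g10 g20 _ _] := round i t.
  rewrite /D g10 g20 !mul0r oppr0; split=> //; field.
  by rewrite gt_eqF.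
have dw0 i (t : R) : is_derive t 1 (fun s => w0 s 0 i)
    (lam t + (w0 t 0 i ^+ 2 + z 0 i ^+ 2) / (2 * g0 i t)).
  have [h _ _] := dw i t; apply: is_derive_eq h _.
  have [-> -> ->] := b012 i t; have [_ _ -> ->] := round i t.
  by field; rewrite gt_eqF.
(* This is the dot-product condition of the block assumption, with b1 = b2 = 0 and b0 = 1 / g0. *)
have tr0 t : \sum_i w0 t 0 i / g0 i t = 0.
  have [_ _ _] := hblock t; rewrite /dot !mxE -!big_split /= => h.
  rewrite -[RHS]h; apply: eq_bigr => i _; rewrite !mxE.
  by have [-> -> ->] := b012 i t; rewrite !mul0r !addr0 mulrC.
have dg0 i (t : R) : is_derive t 1 (g0 i) (w0 t 0 i) by case: (dg i t).
have [C gC] := bounded_round g0_gt0 hz dg0 dw0 tr0.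
(* The squared norm is tr(A A^T) = tr(A^T A) = sum_i 2 g0_i, and each g0_i is at most [C]. *)
exists (Num.sqrt (\sum_(i < m) 2 * C)) => _ [t _ <-].
rewrite /hs_norm /hs_inner mxtrace_mulC trE ler_wsqrtr //.
by apply: ler_sum => i _; rewrite ler_pM2l.
Qed.
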